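(* Let $B_i=\sigma_iU_i$, where $\sigma_i\in(0,1)$ and $U_i$ is a $2\times2$ rotation matrix, $i=1,\ldots,N$, and suppose $\sum_{i=1}^{N}\sigma_i^2<1$. Then the set $E_2(B_1,\ldots,B_N)$ is either empty or is a dense $G_\delta$-subset of $\mathbb R^{2N}$.
   Context: $\mathbb N=\{1,2,\ldots\}$, $N\in\mathbb N$. For contracting homeomorphisms $w_1,\ldots,w_N$ of $\mathbb R^2$ onto itself, the attractor $A$ is the unique non-empty compact set with $A=\bigcup_{i=1}^N w_i(A)$. Let $\Sigma=\{1,\ldots,N\}$ and $w_{\mathbf i}=w_{i_1}\circ\cdots\circ w_{i_n}$ for $\mathbf i=(i_1,\ldots,i_n)\in\Sigma^n$. The system $(w_1,\ldots,w_N)$ satisfies the strong Markov property (SMP) if for every $n\in\mathbb N$ there is an open set $\mathcal O_n\subset\mathbb R^2$ such that (1) $\overline{\mathcal O_n\cap A}=A$; and (2) $w_{\mathbf i}(\mathcal O_n)\cap w_{\mathbf j}(\mathcal O_n)=\emptyset$ for all $\mathbf i\neq\mathbf j\in\Sigma^n$. $E_2(B_1,\ldots,B_N)$ is the set of all ordered $N$-tuples $(\boldsymbol\alpha_1,\ldots,\boldsymbol\alpha_N)$ of points of $\mathbb R^2$ such that the system $w_i(\mathbf x)=B_i(\mathbf x-\boldsymbol\alpha_i)+\boldsymbol\alpha_i$, $i=1,\ldots,N$, satisfies the SMP; it is regarded as a subset of $\mathbb R^{2N}$ with the Euclidean topology. *)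

(* Defs.v *)
From HB Require Import structures.
From mathcomp Require Import all_boot all_order all_algebra.
From mathcomp Require Import all_classical all_reals all_analysis.
Set Implicit Arguments.
Unset Strict Implicit.
Unset Printing Implicit Defensive.
Import Order.TTheory GRing.Theory Num.Theory.
Import numFieldNormedType.Exports.
Local Open Scope classical_set_scope.
Local Open Scope ring_scope.

(* When the maps w i are contractions of a complete metric space, Hutchinson's
   theorem gives exactly one such A, which justifies calling it the attractor
   and quantifying over it existentially in SMP. *)
Definition is_attractor (T : topologicalType) (N : nat) (w : 'I_N -> T -> T)
    (A : set T) : Prop :=
  [/\ A !=set0, compact A & A = \bigcup_(i in [set: 'I_N]) w i @` A].

(* w_(i1, ..., in) = w_i1 \o ... \o w_in: the last letter acts first. *)
Definition word_map (T : Type) (N : nat) (w : 'I_N -> T -> T)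
    (s : seq 'I_N) : T -> T :=
  foldr (fun i f => w i \o f) id s.

Definition SMP (T : topologicalType) (N : nat) (w : 'I_N -> T -> T) : Prop :=
  exists2 A : set T, is_attractor w A &
    forall n : nat, (0 < n)%N ->
      exists O : set T,
        [/\ open O,
            closure (O `&` A) = A &
            forall s t : n.-tuple 'I_N, s != t ->
              (word_map w s @` O) `&` (word_map w t @` O) = set0].

(* Rotation about the origin by the angle theta, acting on column vectors. *)
Definition rotation_mx (R : realType) (theta : R) : 'M[R]_2 :=
  \matrix_(i < 2, j < 2)
    if i == j then cos theta
    else if i == ord0 then - sin theta else sin theta.

Definition is_rotation (R : realType) (U : 'M[R]_2) : Prop :=
  exists theta : R, U = rotation_mx theta.

(* Column i of a is the fixed point of the i-th map. *)
Definition affine_system (R : realType) (d N : nat) (B : 'I_N -> 'M[R]_d)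
    (a : 'M[R]_(d, N)) (i : 'I_N) (x : 'cV[R]_d) : 'cV[R]_d :=
  B i *m (x - col i a) + col i a.

(* An N-tuple of points of R^2 is the 2 x N matrix with these points as its
   columns.  The library's topology on matrices is the entrywise product
   topology, hence 'M[R]_(2, N) carries the Euclidean topology of R^(2N). *)
Definition E2 (R : realType) (N : nat) (B : 'I_N -> 'M[R]_2) :
    set 'M[R]_(2, N) :=
  [set a | SMP (affine_system B a)].

(* Main.v *)
Require Import Defs.
From HB Require Import structures.
From mathcomp Require Import all_boot all_order all_algebra.
From mathcomp Require Import all_classical all_reals all_analysis.
From mathcomp Require Import borel_hierarchy ring lra.
Import Order.TTheory GRing.Theory Num.Theory.
Import numFieldNormedType.Exports.
Set Implicit Arguments.
Unset Strict Implicit.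
Unset Printing Implicit Defensive.
Local Open Scope classical_set_scope.
Local Open Scope ring_scope.

(** Write A_a for the attractor with parameter [a] and pi_a(v) for its point
    with address [v], an infinite word.  Three ideas carry the proof.

    First, the strong Markov property is a countable list of non-inclusions
    between pieces of the attractor: it holds iff
    w_i w_k (A_a) is not contained in w_j (A_a) for all finite words i, j, k
    such that i and j are distinct and of the same length
    ([SMP_all_escape], [all_escape_SMP]).
    If the property holds, a point of A_a in the open set that belongs to the
    level |i| + |k| gives a point of w_i w_k (A_a) outside w_j (A_a), because
    w_i w_k (O) is a neighbourhood of that point and misses every w_j w_l (O)
    with |l| = |k|.
    Conversely the points of A_a whose image under each w_i avoids every other
    w_j (A_a) form a dense subset of A_a, by a Baire argument on cylinders, and
    small balls around these points make up the open set.

    Second, one non-inclusion is an open condition on [a] ([open_escapes]): it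
    says that pi_a(ikv) has positive distance to w_j (A_a) for some [v], and
    the distance between points of the attractor with given addresses varies
    continuously with [a], uniformly in the addresses.

    Third, one non-inclusion is a dense condition as soon as it holds for one
    parameter [c] ([escapes_line], [dense_escapes]).  Identify the plane with
    the complex numbers; the maps being complex affine, pi_a is complex linear
    in [a].  Fix [v] such that pi_c(ikv) is outside w_j (A_c), and move along
    the complex line a + t c.  The parameter [t] is bad only if
    (pi_a(ikv) - pi_a(jv')) + t (pi_c(ikv) - pi_c(jv')) = 0 for some [v'], where
    the coefficient of [t] is bounded away from 0.  The bad parameters with
    [v'] in a given cylinder of level m then lie in a square of side comparable
    to the contraction ratio of the cylinder, so that the bad set has area
    O((sum sigma_i^2)^m) for every m: it is null, and good parameters exist
    arbitrarily close to 0.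

    By the Baire category theorem the parameters that satisfy all the
    non-inclusions form a dense G-delta set, unless there are none. *)

(** * The complex plane as the space of column vectors *)

(** Makes spaces of matrices Banach spaces, the setting of the Baire category
    theorem. *)
HB.instance Definition _ (R : realType) (m n : nat) := Complete.on 'M[R]_(m, n).

Section ComplexPlane.
Variable R : realType.
Implicit Types x y z w : 'cV[R]_2.

Definition re z : R := z ord0 ord0.
Definition im z : R := z ord_max ord0.
Definition cplx (p q : R) : 'cV[R]_2 := \col_i (if i == ord0 then p else q).

(** Multiplication by the complex number [z], acting on column vectors: a
    rotation followed by a scaling. *)
Definition cmx z : 'M[R]_2 :=
  \matrix_(i, j) if i == j then re z else if i == ord0 then - im z else im z.

(** The Euclidean norm is used rather than the maximum norm of matrices, since
    it makes [cmx z] an exact similarity; the two norms differ by a factor of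
    at most 2, so that topological notions can be expressed with either. *)
Definition modulus z : R := Num.sqrt (re z ^+ 2 + im z ^+ 2).

Lemma re_cplx p q : re (cplx p q) = p. Proof. by rewrite /re mxE. Qed.
Lemma im_cplx p q : im (cplx p q) = q. Proof. by rewrite /im mxE. Qed.

Lemma cplx_eq z w : re z = re w -> im z = im w -> z = w.
Proof.
rewrite /re /im => e0 e1; apply/matrixP => i j; rewrite (ord1 j).
have [->//|i0] := eqVneq i ord0.
suff -> : i = ord_max by [].
by apply/val_inj; case: i i0 => [[|[|//]]].
Qed.

Lemma reD z w : re (z + w) = re z + re w. Proof. by rewrite /re mxE. Qed.
Lemma imD z w : im (z + w) = im z + im w. Proof. by rewrite /im mxE. Qed.
Lemma reN z : re (- z) = - re z. Proof. by rewrite /re mxE. Qed.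
Lemma imN z : im (- z) = - im z. Proof. by rewrite /im mxE. Qed.

Lemma reM z w : re (cmx z *m w) = re z * re w - im z * im w.
Proof.
rewrite {1}/re mxE !big_ord_recl big_ord0 !mxE /= addr0 mulNr /re /im.
by rewrite (_ : lift ord0 ord0 = ord_max) //; apply/val_inj.
Qed.

Lemma imM z w : im (cmx z *m w) = im z * re w + re z * im w.
Proof.
rewrite {1}/im mxE !big_ord_recl big_ord0 !mxE /= addr0 /im.
by rewrite (_ : lift ord0 ord0 = ord_max) //; apply/val_inj.
Qed.

Definition cE := (reD, imD, reN, imN, reM, imM, re_cplx, im_cplx).

Lemma cmx_comm z w : cmx z *m cmx w = cmx w *m cmx z.
Proof.
apply/matrixP => i j; rewrite !mxE !big_ord_recl !big_ord0 !mxE.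
by case: i => [[|[|//]] ?]; case: j => [[|[|//]] ?] /=; ring.
Qed.

Lemma modulus_ge0 z : 0 <= modulus z. Proof. exact: sqrtr_ge0. Qed.
Hint Resolve modulus_ge0 : core.

Lemma modulus_sqr z : modulus z ^+ 2 = re z ^+ 2 + im z ^+ 2.
Proof. by rewrite sqr_sqrtr // addr_ge0 // sqr_ge0. Qed.

Lemma modulusM z w : modulus (cmx z *m w) = modulus z * modulus w.
Proof.
rewrite /modulus -sqrtrM ?addr_ge0 ?sqr_ge0 // !cE; congr Num.sqrt; ring.
Qed.

Lemma modulus0 : modulus 0 = 0.
Proof. by rewrite /modulus /re /im !mxE expr0n addr0 sqrtr0. Qed.

Lemma modulusN z : modulus (- z) = modulus z.
Proof. by rewrite /modulus !cE !sqrrN. Qed.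

Lemma modulusC z w : modulus (z - w) = modulus (w - z).
Proof. by rewrite -modulusN opprB. Qed.

Lemma modulus_eq0 z : modulus z = 0 -> z = 0.
Proof.
move=> h; have := modulus_sqr z; rewrite h expr0n => /esym/eqP.
rewrite paddr_eq0 ?sqr_ge0 // !sqrf_eq0 => /andP[/eqP a /eqP b].
by apply: cplx_eq; rewrite ?a ?b /re /im mxE.
Qed.

Lemma modulusD z w : modulus (z + w) <= modulus z + modulus w.
Proof.
rewrite -(ler_pXn2r (n := 2)) ?nnegrE ?addr_ge0 // modulus_sqr !cE.
have h : re z * re w + im z * im w <= modulus z * modulus w.
  apply: le_trans (ler_norm _) _.
  rewrite -(ler_pXn2r (n := 2)) ?nnegrE ?mulr_ge0 // real_normK ?num_real //.
  rewrite exprMn !modulus_sqr -subr_ge0.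
  rewrite (_ : _ - _ = (re z * im w - im z * re w) ^+ 2) ?sqr_ge0 //; ring.
have := modulus_sqr z; have := modulus_sqr w; lra.
Qed.

Lemma modulus_triangle y x z :
  modulus (x - z) <= modulus (x - y) + modulus (y - z).
Proof. by rewrite -{1}(subrKA y); exact: modulusD. Qed.

Lemma cmx1 n (A : 'M[R]_(2, n)) : cmx (cplx 1 0) *m A = A.
Proof.
rewrite (_ : cmx _ = 1%:M) ?mul1mx //; apply/matrixP => i j.
by rewrite !mxE re_cplx im_cplx oppr0 if_same; case: eqP.
Qed.

Lemma cmx_surj z y : 0 < modulus z -> exists x, cmx z *m x = y.
Proof.
move=> z0; have : re z ^+ 2 + im z ^+ 2 != 0.
  by rewrite -modulus_sqr expf_neq0 // gt_eqF.
move=> d0; pose d := re z ^+ 2 + im z ^+ 2.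
exists (cmx (cplx (re z / d) (- im z / d)) *m y).
by apply: cplx_eq; rewrite !cE /d; field.
Qed.

Lemma re_le_modulus z : `|re z| <= modulus z.
Proof.
rewrite -(ler_pXn2r (n := 2)) ?nnegrE // modulus_sqr real_normK ?num_real //.
by rewrite lerDl sqr_ge0.
Qed.

Lemma im_le_modulus z : `|im z| <= modulus z.
Proof.
rewrite -(ler_pXn2r (n := 2)) ?nnegrE // modulus_sqr real_normK ?num_real //.
by rewrite lerDr sqr_ge0.
Qed.

Lemma modulus_le z : modulus z <= `|re z| + `|im z|.
Proof.
rewrite -(ler_pXn2r (n := 2)) ?nnegrE ?addr_ge0 // modulus_sqr sqrrD.
rewrite !real_normK ?num_real //.
have := mulr_ge0 (normr_ge0 (re z)) (normr_ge0 (im z)); lra.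
Qed.

Lemma modulus_lt_ball x y e : modulus (x - y) < e -> ball x e y.
Proof.
move=> h; split=> [|i j]; first exact: le_lt_trans h.
rewrite (ord1 j) /ball /=.
have -> : x i ord0 - y i ord0 = (x - y) i ord0 by rewrite !mxE.
have [->|i0] := eqVneq i ord0.
  by apply: le_lt_trans h; exact: re_le_modulus.
have -> : i = ord_max by apply/val_inj; case: i i0 => [[|[|//]]].
by apply: le_lt_trans h; exact: im_le_modulus.
Qed.

Lemma ball_columns N (a a' : 'M[R]_(2, N)) (e : R) :
  0 < e -> (forall i, modulus (col i a - col i a') < e) -> ball a e a'.
Proof.
move=> e0 h; split=> // p q.
by have [_ /(_ p ord0)] := modulus_lt_ball (h q); rewrite !mxE.
Qed.

Lemma ball_modulus_lt x y e : ball x e y -> modulus (x - y) < 2 * e.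
Proof.
move=> [e0 h]; apply: le_lt_trans (modulus_le _) _; rewrite !cE.
have := h ord0 ord0; have := h ord_max ord0; rewrite /ball /= /re /im; lra.
Qed.

Lemma open_modulusP (A : set 'cV[R]_2) :
  open A <-> forall x, A x -> exists2 e : R, 0 < e &
    forall y, modulus (x - y) < e -> A y.
Proof.
rewrite openE; split=> h x Ax; have := h x Ax.
  by move=> /nbhs_ballP[e /= e0 b]; exists e => // y /modulus_lt_ball/b.
move=> [e e0 b]; apply/nbhs_ballP; exists (e / 2) => /=; first by rewrite divr_gt0.
by move=> y /ball_modulus_lt yx; apply: b; rewrite mulrC divfK in yx.
Qed.

Lemma closure_modulusP (A : set 'cV[R]_2) x :
  closure A x <-> forall e : R, 0 < e -> exists2 y, A y & modulus (x - y) < e.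
Proof.
split=> [cl e e0|h V].
  have /cl[y [Ay xy]] : nbhs x (ball x (e / 2)).
    by apply: nbhsx_ballx; rewrite divr_gt0.
  exists y => //; have := ball_modulus_lt xy; lra.
move=> /nbhs_ballP[e /= e0 eV]; have [y Ay xy] := h _ e0.
by exists y; split => //; apply/eV/modulus_lt_ball.
Qed.

Lemma modulus_cauchy (u : nat -> 'cV[R]_2) :
  (forall e : R, 0 < e -> exists n0, forall n m, (n0 <= n)%N -> (n0 <= m)%N ->
     modulus (u n - u m) < e) ->
  exists l, forall e : R, 0 < e -> exists n0, forall n, (n0 <= n)%N ->
     modulus (u n - l) < e.
Proof.
move=> h; have : cvgn u.
  apply/cauchy_cvgP/cauchy_exP => e e0.
  have [n0 hn] := h e e0.
  by exists (u n0), n0 => // n /= n0n; exact/modulus_lt_ball/hn.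
move=> /cvg_ex[l ul]; exists l => e e0.
have e20 : 0 < e / 2 by rewrite divr_gt0.
have [n0 _ hn] := cvg_ball ul e20.
exists n0 => n /hn /ball_modulus_lt; rewrite modulusC; lra.
Qed.

End ComplexPlane.
#[global] Hint Extern 0 (is_true (0 <= modulus _)) => solve [apply: modulus_ge0] : core.

(** * Areas of finite covers by squares *)

Section Area.
Variable R : realType.

Definition square (c : R * R) (r : R) : set (R * R) :=
  [set` `[c.1 - r, c.1 + r]%R] `*` [set` `[c.2 - r, c.2 + r]%R].

Local Notation area := (@lebesgue_measure R \x @lebesgue_measure R)%E.

Lemma measurable_square c r : measurable (square c r).
Proof. by apply: measurableX; exact: measurable_itv. Qed.

Lemma area_square c r : 0 <= r -> area (square c r) = ((2 * r) ^+ 2)%:E.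
Proof.
move=> r0; rewrite product_measure1E; [|exact: measurable_itv..].
have side (p : R) : lebesgue_measure [set` `[p - r, p + r]%R] = (2 * r)%:E.
  rewrite lebesgue_measure_itv /= lte_fin; case: ifPn => [_|].
    by rewrite -EFinB; congr EFin; ring.
  rewrite -leNgt => h; congr EFin; lra.
by rewrite /= !side -EFinM expr2.
Qed.

Lemma area_cover_le (I : eqType) (L : seq I) (c : I -> R * R) (r : I -> R)
    (A : set (R * R)) :
  (forall i, 0 <= r i) -> measurable A ->
  (forall z, A z -> exists2 i, i \in L & square (c i) (r i) z) ->
  (area A <= (\sum_(i <- L) (2 * r i) ^+ 2)%:E)%E.
Proof.
move=> r0; elim: L A => [|i L IH] A mA cov.
  rewrite big_nil (_ : A = set0) ?measure0 //; apply/seteqP.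
  by split => // z /cov[].
have mS := measurable_square (c i) (r i).
rewrite big_cons EFinD addeC.
have -> := measureDI area mA mS.
rewrite leeD //.
  apply: IH; first exact: measurableD.
  move=> z [/cov[k]]; rewrite inE => /orP[/eqP->//|kL kz _]; by exists k.
rewrite -(area_square (c i) (r0 i)); apply: le_measure; rewrite ?inE //.
exact: measurableI.
Qed.

(** Lebesgue measure enters only through this consequence, a comparison of real
    numbers. *)
Lemma square_cover_le (I : eqType) (L : seq I) (c : I -> R * R) (r : I -> R) s :
  0 <= s -> (forall i, 0 <= r i) ->
  (forall p q, `|p| <= s -> `|q| <= s ->
    exists2 i, i \in L & `|p - (c i).1| <= r i /\ `|q - (c i).2| <= r i) ->
  (2 * s) ^+ 2 <= \sum_(i <- L) (2 * r i) ^+ 2.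
Proof.
move=> s0 r0 cov; rewrite -lee_fin -(area_square (0, 0) s0).
apply: (area_cover_le (c := c)) => //; first exact: measurable_square.
move=> [p q] [/=]; rewrite !in_itv /= !sub0r !add0r -!ler_norml => ps qs.
have [i iL [h1 h2]] := cov _ _ ps qs; exists i => //.
by split; rewrite /= in_itv /= -ler_distl.
Qed.

End Area.

(** * Infinite words *)

Section Words.
Variable T : Type.
Implicit Types (v : nat -> T) (s : seq T).

Definition shift n v : nat -> T := fun k => v (n + k)%N.

Lemma mkseq_add v n m : mkseq v (n + m) = mkseq v n ++ mkseq (shift n v) m.
Proof.
rewrite /mkseq iotaD map_cat add0n -[in iota n m](addn0 n) iotaDl -map_comp.
by [].
Qed.

Lemma eq_mkseq_ord v v' m :
  [ffun p : 'I_m => v p] = [ffun p : 'I_m => v' p] -> mkseq v m = mkseq v' m.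
Proof.
move=> /ffunP h; apply/eq_in_map => p; rewrite mem_iota add0n => /= pm.
by have := h (Ordinal pm); rewrite !ffunE.
Qed.

Definition prepend s v : nat -> T :=
  foldr (fun i u n => if n is k.+1 then u k else i) v s.

Lemma shift_prepend s v : shift (size s) (prepend s v) = v.
Proof. by elim: s. Qed.

Lemma mkseq_prepend s v : mkseq (prepend s v) (size s) = s.
Proof.
elim: s => // i s IH; rewrite /= -[(size s).+1]add1n mkseq_add /=.
by rewrite [X in _ :: X]IH.
Qed.

(** Dependent choice along finite words; it turns successive choices of smaller
    and smaller pieces of the attractor into an address. *)
Lemma infinite_word (P : seq T -> Prop) :
  P [::] -> (forall s, P s -> exists i, P (rcons s i)) ->
  exists v, forall n, P (mkseq v n).
Proof.
move=> P0 PS.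
have T0 : T by have [i _] := cid (PS _ P0).
have [|f hf] := @choice _ _ (fun s i => P s -> P (rcons s i)).
  move=> s; have [/PS[i Pi]|nP] := pselect (P s); first by exists i.
  by exists T0.
pose u := fix u n := if n is k.+1 then rcons (u k) (f (u k)) else [::].
have uE n : mkseq (fun k => f (u k)) n = u n.
  by elim: n => // n IH; rewrite mkseqS IH.
exists (fun k => f (u k)) => n; rewrite uE.
by elim: n => // n; exact: hf.
Qed.

End Words.

Lemma ultra_finite_cover (T : Type) (I : finType) (F : set_system T)
    (E : I -> set T) :
  UltraFilter F -> F (\bigcup_(i in [set: I]) E i) -> exists i, F (E i).
Proof.
move=> UF FE; apply: contrapT => nE.
have : \forall x \near F, forall i, (~` E i) x.
  apply: filter_forall => i; have [Ei|//] := in_ultra_setVsetC (E i) UF.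
  by case: nE; exists i.
move=> nF; have [x [[i _ Ei]]] := filter_ex (filterI FE nF).
by move=> /(_ i).
Qed.

Lemma small_geometric (R : realType) (r C e : R) :
  0 < r < 1 -> 0 <= C -> 0 < e ->
  exists n0, forall n, (n0 <= n)%N -> C * r ^+ n < e.
Proof.
move=> /andP[r0 r1] C0 e0.
have C1 : 0 < C + 1 by rewrite ltr_wpDl.
have h : (GRing.exp r) @ \oo --> (0 : R).
  by apply: cvg_expr; rewrite ger0_norm // ltW.
have eC : 0 < e / (C + 1) by rewrite divr_gt0.
have [n0 _ hn] := cvgr0_norm_lt _ h _ eC.
exists n0 => n /hn /=; rewrite ger0_norm ?exprn_ge0 1?ltW // => hlt.
apply: le_lt_trans (_ : (C + 1) * r ^+ n < e).
  by rewrite ler_wpM2r ?exprn_ge0 1?ltW // ltrDl.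
by rewrite mulrC -ltr_pdivlMr.
Qed.

(** * The coding map *)

Section Coding.
Variables (R : realType) (N : nat) (b : 'I_N -> 'cV[R]_2) (rho : R).
Hypothesis b_gt0 : forall i, 0 < modulus (b i).
Hypothesis b_le : forall i, modulus (b i) <= rho.
Hypothesis rho01 : 0 < rho < 1.
Implicit Types (a c : 'M[R]_(2, N)) (s : seq 'I_N) (v : nat -> 'I_N).
Implicit Types (x y t : 'cV[R]_2).

Let rho_lt1 : 0 < 1 - rho. Proof. by rewrite subr_gt0; case/andP: rho01. Qed.

Definition wmap a s : 'cV[R]_2 -> 'cV[R]_2 :=
  word_map (affine_system (fun i => cmx (b i)) a) s.

Definition ratio s : R := \prod_(i <- s) modulus (b i).

Lemma wmap_cat a s1 s2 x : wmap a (s1 ++ s2) x = wmap a s1 (wmap a s2 x).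
Proof. by rewrite /wmap; elim: s1 => //= i s1 ->. Qed.

Lemma wmap_dist a s x y :
  modulus (wmap a s x - wmap a s y) = ratio s * modulus (x - y).
Proof.
rewrite /wmap /ratio; elim: s => [|i s IH] /=; first by rewrite big_nil mul1r.
rewrite big_cons -mulrA -IH -modulusM /affine_system opprD addrACA subrr addr0.
by rewrite -mulmxBr opprB addrA subrK.
Qed.

(** Multiplication by [t] commutes with the linear parts because complex
    multiplication is commutative; this is what makes the whole construction
    complex linear in the parameter. *)
Lemma wmap_linear a c t s x y :
  wmap (a + cmx t *m c) s (x + cmx t *m y) = wmap a s x + cmx t *m wmap c s y.
Proof.
rewrite /wmap; elim: s => //= i s ->; set p := word_map _ _ x.
set q := word_map _ _ y; rewrite /affine_system.
have -> : col i (a + cmx t *m c) = col i a + cmx t *m col i c.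
  by rewrite linearD /= !colE mulmxA.
rewrite opprD addrACA -mulmxBr mulmxDr mulmxA cmx_comm -mulmxA addrACA.
by rewrite -mulmxDr.
Qed.

Lemma wmap_surj a s y : exists x, wmap a s x = y.
Proof.
rewrite /wmap; elim: s y => [|i s IH] y /=; first by exists y.
have [z hz] := cmx_surj (y - col i a) (b_gt0 i).
have [x hx] := IH (z + col i a); exists x.
by rewrite hx /affine_system addrK hz subrK.
Qed.

Lemma ratio_gt0 s : 0 < ratio s.
Proof. by apply: prodr_gt0 => i _. Qed.

Lemma ratio_le s : ratio s <= rho ^+ size s.
Proof.
rewrite /ratio; elim: s => [|i s IH]; first by rewrite big_nil.
by rewrite big_cons /= exprS ler_pM //; exact: (ltW (ratio_gt0 s)).
Qed.

(** The disc of this radius about the origin is mapped into itself by every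
    map of the system. *)
Definition radius a : R := 2 * (\sum_i modulus (col i a)) / (1 - rho).

Lemma radius_ge0 a : 0 <= radius a.
Proof. by rewrite divr_ge0 ?mulr_ge0 ?sumr_ge0 // ltW. Qed.
Hint Resolve radius_ge0 : core.

Lemma wmap_radius a s x :
  modulus x <= radius a -> modulus (wmap a s x) <= radius a.
Proof.
rewrite /wmap; elim: s => //= i s IH /IH; move: (word_map _ _ x) => y yr.
rewrite /affine_system; apply: le_trans (modulusD _ _) _; rewrite modulusM.
have col_le : modulus (col i a) <= \sum_i modulus (col i a).
  by rewrite (bigD1 i) //= lerDl sumr_ge0.
have rE : radius a * (1 - rho) = 2 * \sum_i modulus (col i a).
  by rewrite /radius divfK // gt_eqF.
have := modulusD y (- col i a); rewrite modulusN => yc.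
apply: le_trans (_ : rho * (radius a + modulus (col i a)) + modulus (col i a) <= _).
  by rewrite lerD2r ler_pM // (le_trans yc) // lerD2r.
have : rho * modulus (col i a) <= modulus (col i a).
  by rewrite ler_piMl //; case/andP: rho01 => _ /ltW.
lra.
Qed.

Lemma wmap_mkseq_dist a v n x y C :
  modulus (x - y) <= C ->
  modulus (wmap a (mkseq v n) x - wmap a (mkseq v n) y) <= C * rho ^+ n.
Proof.
move=> xy; rewrite wmap_dist mulrC ler_pM //; first exact/ltW/ratio_gt0.
by have := ratio_le (mkseq v n); rewrite size_mkseq.
Qed.

(** The iterates at the origin along a word form a Cauchy sequence: those of
    index at least [n] lie in the image of the invariant disc under the first
    [n] maps. *)
Lemma coding_exists a v :
  exists l, forall n, modulus (wmap a (mkseq v n) 0 - l) <= radius a * rho ^+ n.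
Proof.
have dist n m : (n <= m)%N ->
    modulus (wmap a (mkseq v n) 0 - wmap a (mkseq v m) 0) <= radius a * rho ^+ n.
  move=> /subnKC <-; rewrite mkseq_add wmap_cat; apply: wmap_mkseq_dist.
  by rewrite sub0r modulusN wmap_radius // modulus0.
have [|l hl] := @modulus_cauchy R (fun n => wmap a (mkseq v n) 0).
  move=> e e0; have [n0 hn] := small_geometric rho01 (radius_ge0 a) e0.
  exists n0 => n m n0n n0m.
  wlog nm : n m n0n n0m / (n <= m)%N.
    move=> W; case/orP: (leq_total n m) => nm; first exact: W.
    by rewrite modulusC; exact: W.
  exact: le_lt_trans (dist _ _ nm) (hn _ n0n).
exists l => n; apply/ler_addgt0Pr => e e0; have [m0 hm] := hl e e0.
apply: le_trans (modulus_triangle (wmap a (mkseq v (maxn n m0)) 0) _ _) _.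
by rewrite lerD ?dist ?leq_maxl // ltW // hm // leq_maxr.
Qed.

(** The limit of the maps w_v0 ... w_vn at the origin: the point of the
    attractor with address [v]. *)
Definition coding a v : 'cV[R]_2 := projT1 (cid (coding_exists a v)).

Lemma codingP a v n :
  modulus (wmap a (mkseq v n) 0 - coding a v) <= radius a * rho ^+ n.
Proof. by rewrite /coding; case: cid. Qed.

Lemma coding_unique a v l :
  (forall e : R, 0 < e -> exists n0, forall n, (n0 <= n)%N ->
     modulus (wmap a (mkseq v n) 0 - l) < e) -> coding a v = l.
Proof.
move=> h; apply/eqP; rewrite -subr_eq0; apply/eqP/modulus_eq0/le_anti.
rewrite modulus_ge0 andbT; apply/ler_addgt0Pr => e e0; rewrite add0r.
have e20 : 0 < e / 2 by rewrite divr_gt0.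
have [n0 hn] := h _ e20.
have [n1 hm] := small_geometric rho01 (radius_ge0 a) e20.
have := hn _ (leq_maxl n0 n1); have := hm _ (leq_maxr n0 n1).
have := codingP a v (maxn n0 n1); rewrite modulusC.
have := modulus_triangle (wmap a (mkseq v (maxn n0 n1)) 0) (coding a v) l.
lra.
Qed.

Lemma coding_shift a v n :
  coding a v = wmap a (mkseq v n) (coding a (shift n v)).
Proof.
apply: coding_unique => e e0.
have [n0 hn] := small_geometric rho01 (radius_ge0 a) e0.
exists (n + n0)%N => m nm.
have nle : (n <= m)%N by apply: leq_trans nm; exact: leq_addr.
rewrite -(subnKC nle) mkseq_add wmap_cat wmap_dist.
apply: le_lt_trans (hn (m - n)%N _); last by rewrite leq_subRL.
apply: le_trans (codingP a (shift n v) (m - n)); rewrite ler_piMl //.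
by apply: le_trans (ratio_le _) _; rewrite exprn_ile1 ?ltW //; case/andP: rho01.
Qed.

Lemma coding_radius a v : modulus (coding a v) <= radius a.
Proof. by have := codingP a v 0; rewrite /wmap sub0r modulusN expr0 mulr1. Qed.

(** A criterion that avoids limits: being in the image of one fixed disc under
    every prefix of [v] determines a point. *)
Lemma coding_address a v l C :
  (forall n, exists2 y, modulus y <= C & l = wmap a (mkseq v n) y) ->
  l = coding a v.
Proof.
move=> h; symmetry; apply: coding_unique => e e0.
have C0 : 0 <= C by have [y yC _] := h 0%N; exact: le_trans yC.
have [n0 hn] := small_geometric rho01 C0 e0.
exists n0 => n /hn; apply: le_lt_trans; have [y yC ->] := h n.
by apply: wmap_mkseq_dist; rewrite sub0r modulusN.
Qed.

Lemma coding_linear a c t v :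
  coding (a + cmx t *m c) v = coding a v + cmx t *m coding c v.
Proof.
symmetry; apply: (@coding_address _ _ _ (radius a + modulus t * radius c)) => n.
exists (coding a (shift n v) + cmx t *m coding c (shift n v)).
  apply: le_trans (modulusD _ _) _; rewrite modulusM lerD ?coding_radius //.
  by rewrite ler_wpM2l // coding_radius.
by rewrite wmap_linear -!coding_shift.
Qed.

Lemma coding_prefix_dist a v v' n : mkseq v n = mkseq v' n ->
  modulus (coding a v - coding a v') <= 2 * radius a * ratio (mkseq v n).
Proof.
move=> vv'; rewrite (coding_shift a v n) (coding_shift a v' n) -vv' wmap_dist mulrC.
rewrite ler_wpM2r ?(ltW (ratio_gt0 _)) //.
have := modulusD (coding a (shift n v)) (- coding a (shift n v')); rewrite modulusN.
have := coding_radius a (shift n v); have := coding_radius a (shift n v'); lra.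
Qed.

(** * The attractor *)

Definition attractor a : set 'cV[R]_2 := range (coding a).

Lemma coding_prepend a s v :
  coding a (prepend s v) = wmap a s (coding a v).
Proof. by rewrite (coding_shift a _ (size s)) mkseq_prepend shift_prepend. Qed.

(** An ultrafilter on the attractor selects one piece of each level, hence one
    address, and converges to the point with that address. *)
Lemma compact_attractor a : compact (attractor a).
Proof.
rewrite compact_ultra => F UF FA.
have [||v hv] := @infinite_word 'I_N (fun s => F (wmap a s @` attractor a)).
- by rewrite /wmap /= image_id.
- move=> s Fs.
  apply: (ultra_finite_cover (E := fun i => wmap a (rcons s i) @` attractor a)).
  apply: filterS Fs => _ [_ [v _ <-] <-]; exists (v 0%N) => //.
  exists (coding a (shift 1 v)); first by exists (shift 1 v).
  by rewrite -cats1 wmap_cat (coding_shift a v 1).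
exists (coding a v); split; first by exists v.
move=> V /nbhs_ballP[e /= e0 eV].
have r0 : 0 <= 2 * radius a by rewrite mulr_ge0 // radius_ge0.
have [n hn] := small_geometric rho01 r0 e0.
apply: filterS (hv n) => _ [_ [v' _ <-] <-]; apply/eV/modulus_lt_ball.
rewrite (coding_shift a v n); apply: le_lt_trans (hn n (leqnn n)).
apply: wmap_mkseq_dist; apply: le_trans (modulusD _ _) _; rewrite modulusN.
have := coding_radius a (shift n v); have := coding_radius a v'; lra.
Qed.

Lemma closed_attractor a : closed (attractor a).
Proof.
by apply: compact_closed; [exact: norm_hausdorff | exact: compact_attractor].
Qed.

Let system a := affine_system (fun i => cmx (b i)) a.

Lemma is_attractor_attractor a : (0 < N)%N -> is_attractor (system a) (attractor a).
Proof.
move=> hN; split; [|exact: compact_attractor|].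
  by exists (coding a (fun=> Ordinal hN)); exists (fun=> Ordinal hN).
apply/seteqP; split=> [_ [v _ <-]|_ [i _ [_ [v _ <-] <-]]].
  exists (v 0%N) => //; exists (coding a (shift 1 v)); first by exists (shift 1 v).
  by rewrite (coding_shift a v 1).
by exists (prepend [:: i] v) => //; rewrite coding_prepend.
Qed.

(** A point of a self-similar compact set has an address, since it can be pulled
    back indefinitely inside a bounded set; conversely the point with a given
    address is a limit of images of an arbitrary point of that set. *)
Lemma attractor_unique a (A : set 'cV[R]_2) :
  is_attractor (system a) A -> A = attractor a.
Proof.
move=> [[x0 Ax0] cA AE].
have [C AC] : exists C : R, forall y, A y -> modulus y <= C.
  have [M [_ hM]] := compact_bounded cA.
  exists (2 * (M + 2)) => y /(hM (M + 1)); rewrite ltrDl ltr01 => /(_ isT) yM.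
  rewrite -modulusN -[- y]sub0r; apply/ltW/ball_modulus_lt.
  by rewrite mx_norm_ball /ball_ /= sub0r normrN; apply: le_lt_trans yM _; lra.
have stable s y : A y -> A (wmap a s y).
  rewrite /wmap; elim: s y => //= i s IH y /IH h; rewrite AE.
  by exists i => //; exists (word_map (system a) s y).
apply/seteqP; split=> [x Ax|_ [v _ <-]].
  have [||v hv] := @infinite_word _ (fun s => exists2 y, A y & x = wmap a s y).
  - by exists x.
  - move=> s [y Ay ->]; move: (Ay); rewrite {1}AE => -[i _ [z Az <-]].
    by exists i, z => //; rewrite -cats1 wmap_cat.
  exists v => //; symmetry; apply: (@coding_address _ _ _ C) => n.
  by have [y Ay xE] := hv n; exists y => //; exact: AC.
have clA : closed A by apply: compact_closed => //; exact: norm_hausdorff.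
apply: clA; apply/closure_modulusP => e e0.
have r0 : 0 <= radius a + C.
  by rewrite addr_ge0 ?radius_ge0 // (le_trans _ (AC _ Ax0)).
have [n hn] := small_geometric rho01 r0 e0.
exists (wmap a (mkseq v n) x0); first exact: stable.
rewrite (coding_shift a v n); apply: le_lt_trans (hn n (leqnn n)).
apply: wmap_mkseq_dist; apply: le_trans (modulusD _ _) _; rewrite modulusN.
by rewrite lerD ?coding_radius ?AC.
Qed.

(** Pulling back by the bijection [wmap a j], a similarity, reduces this to the
    closedness of the attractor. *)
Lemma cylinder_gap a j z :
  (forall v, z <> wmap a j (coding a v)) ->
  exists2 e : R, 0 < e & forall v, e <= modulus (z - wmap a j (coding a v)).
Proof.
move=> hz; have [z0 z0E] := wmap_surj a j z.
have nA : ~ attractor a z0 by move=> [v _ vz0]; apply: (hz v); rewrite vz0.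
have /open_modulusP/(_ z0 nA)[e e0 he] : open (~` attractor a).
  by rewrite openC; exact: closed_attractor.
exists (ratio j * e); first by rewrite mulr_gt0 ?ratio_gt0.
move=> v; rewrite -z0E wmap_dist ler_pM2l ?ratio_gt0 // leNgt.
by apply/negP => /he; apply; exists v.
Qed.

(** * The strong Markov property as a family of non-inclusions *)

(** One non-inclusion between pieces of the attractor: w_i w_k (A) has a point
    outside w_j (A). *)
Definition escapes i j k : set 'M[R]_(2, N) :=
  [set a | exists v, forall v',
    wmap a (i ++ k) (coding a v) <> wmap a j (coding a v')].

Definition all_escape : set 'M[R]_(2, N) :=
  [set a | forall i j k, size i = size j -> i != j -> escapes i j k a].

(** If a point of w_i w_k (O) were in w_j (A), it would be in some w_j w_l (A)
    with |l| = |k|, hence a limit of points of w_j w_l (O); but w_i w_k (O) is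
    open, and disjoint from w_j w_l (O) since i k and j l are distinct words of
    the same length. *)
Lemma SMP_all_escape a : SMP (system a) -> all_escape a.
Proof.
move=> [A attA] HO i j k ij neq.
have AE := attractor_unique attA; have [[x0 Ax0] _ _] := attA.
have n0 : (0 < size i + size k)%N.
  by case: i j ij neq => [|? ?] [].
have [G [oG clG disj]] := HO _ n0.
have /closure_modulusP/(_ 1 ltr01)[x [Gx Ax] _] : closure (G `&` A) x0 by rewrite clG.
move: (Ax); rewrite AE => -[v _ vx]; exists v => v' E.
set l := mkseq v' (size k); set z := coding a (shift (size k) v').
have E' : wmap a (i ++ k) x = wmap a (j ++ l) z.
  by rewrite (wmap_cat a j) /l /z -coding_shift -vx.
have [e e0 he] := (open_modulusP _).1 oG x Gx.
have /closure_modulusP cz : closure (G `&` A) z.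
  by rewrite clG AE; exists (shift (size k) v').
have d0 : 0 < ratio (i ++ k) * e / ratio (j ++ l).
  by rewrite divr_gt0 ?mulr_gt0 ?ratio_gt0.
have [z' [Gz' _] zz'] := cz _ d0.
(* [d0] is chosen so that the similarity ratios cancel and [y] falls in the
   ball around [x] contained in [G]. *)
have [y yE] := wmap_surj a (i ++ k) (wmap a (j ++ l) z').
have Gy : G y.
  apply: he; rewrite -(ltr_pM2l (ratio_gt0 (i ++ k))) -(wmap_dist a) yE E'.
  by rewrite wmap_dist mulrC -ltr_pdivlMr ?ratio_gt0.
have si : size (i ++ k) == (size i + size k)%N by rewrite size_cat.
have sj : size (j ++ l) == (size i + size k)%N by rewrite size_cat size_mkseq ij.
have st : Tuple si != Tuple sj by rewrite -val_eqE /= eqseq_cat // negb_and neq.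
have : set0 (wmap a (i ++ k) y).
  by rewrite -(disj _ _ st); split => /=; [exists y | exists z'].
by [].
Qed.

Definition apart a s (i j : seq 'I_N) :=
  forall v v', wmap a (i ++ s) (coding a v) <> wmap a j (coding a v').

(** Unlike [escapes], this is inherited by every sub-piece of the piece with
    address [i ++ s]. *)
Lemma apart_cat a s k i j : apart a s i j -> apart a (s ++ k) i j.
Proof.
by move=> h v v'; rewrite catA wmap_cat -coding_prepend; exact: h.
Qed.

(** A piece small enough around the escaping point keeps a positive distance
    from the closed piece [j]. *)
Lemma apart_extend a s i j : escapes i j s a -> exists k, apart a (s ++ k) i j.
Proof.
move=> [v /cylinder_gap[e e0 he]].
have r0 : 0 <= 2 * radius a by rewrite mulr_ge0 // radius_ge0.
have [n hn] := small_geometric rho01 r0 e0.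
exists (mkseq v n) => v1 v' E; have := he v'; apply/negP; rewrite -ltNge -E.
rewrite (coding_shift a v n) catA (wmap_cat a (i ++ s) (mkseq v n)) wmap_dist.
have dd : modulus (coding a (shift n v) - coding a v1) <= 2 * radius a.
  apply: le_trans (modulusD _ _) _; rewrite modulusN.
  have := coding_radius a (shift n v); have := coding_radius a v1; lra.
apply: le_lt_trans (hn n (leqnn n)); apply: le_trans (wmap_mkseq_dist a v n dd).
rewrite ler_piMl //; apply: le_trans (ratio_le _) _.
by rewrite exprn_ile1 ?ltW //; case/andP: rho01.
Qed.

(** Pairs are treated one after the other, each extension of the word preserving
    what has been achieved: a finite Baire argument on cylinders. *)
Lemma apart_extend_all a n (L : seq (n.-tuple 'I_N * n.-tuple 'I_N)) s :
  all_escape a ->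
  exists k, forall p : n.-tuple 'I_N * n.-tuple 'I_N,
    p \in L -> p.1 != p.2 -> apart a (s ++ k) p.1 p.2.
Proof.
move=> ha; elim: L => [|[i j] L [k hk]]; first by exists [::].
have [->|ij] := eqVneq i j.
  by exists k => p; rewrite inE => /orP[/eqP->/eqP//|]; exact: hk.
have [|k' hk'] := @apart_extend a (s ++ k) i j.
  by apply: ha; rewrite ?size_tuple.
exists (k ++ k') => p; rewrite inE catA => /orP[/eqP-> _|pL pn]; first exact: hk'.
by apply: apart_cat; exact: hk.
Qed.

Lemma gap_tuples a n x :
  (forall i j : n.-tuple 'I_N, i != j ->
    forall v, wmap a i x <> wmap a j (coding a v)) ->
  exists2 e : R, 0 < e & forall i j : n.-tuple 'I_N, i != j ->
    forall v, e <= modulus (wmap a i x - wmap a j (coding a v)).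
Proof.
move=> h.
have : \forall e \near 0^'+, forall p : n.-tuple 'I_N * n.-tuple 'I_N, p.1 != p.2 ->
    forall v, e <= modulus (wmap a p.1 x - wmap a p.2 (coding a v)).
  apply: filter_forall => -[i j] /=.
  have [->|ij] := eqVneq i j; first by near=> e.
  have [e e0 he] := cylinder_gap (h i j ij).
  near=> d => _ v; apply: le_trans (he v); near: d.
  exact: nbhs_right_le.
move=> H; have [e [e0 he]] := filter_ex (filterI (nbhs_right_gt 0) H).
by exists e => // i j ij v; exact: (he (i, j)).
Unshelve. all: by end_near. Qed.

(** The open set consists of the [z] closer to some point [x] of the attractor
    than half of a gap between the images w_i (x) and the pieces w_j (A) with
    i <> j.  If two images of this set met, two points of distinct pieces would
    be closer than the average, hence the maximum, of their gaps. *)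
Lemma all_escape_SMP a : (0 < N)%N -> all_escape a -> SMP (system a).
Proof.
move=> hN ha; exists (attractor a); first exact: is_attractor_attractor.
move=> n _.
exists [set z | exists x e, [/\ attractor a x,
  forall i j : n.-tuple 'I_N, i != j ->
    forall v, e <= modulus (wmap a i x - wmap a j (coding a v)) &
  2 * modulus (z - x) < e]].
split.
- apply/open_modulusP => z [x [e [Ax he zx]]].
  exists (e / 2 - modulus (z - x)); first lra.
  move=> y zy; exists x, e; split => //.
  have := modulus_triangle z y x; rewrite (modulusC y z); lra.
- apply/seteqP; split.
    by move=> z /(closureS (@subIsetr _ _ _))/closed_attractor.
  move=> _ [v _ <-]; apply/closure_modulusP => e e0.
  have r0 : 0 <= 2 * radius a by rewrite mulr_ge0 // radius_ge0.
  have [m hm] := small_geometric rho01 r0 e0.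
  have [k hk] := apart_extend_all
    (enum {: n.-tuple 'I_N * n.-tuple 'I_N}) (mkseq v m) ha.
  have Ay : attractor a (wmap a (mkseq v m ++ k) (coding a v)).
    by rewrite -coding_prepend; exists (prepend (mkseq v m ++ k) v).
  exists (wmap a (mkseq v m ++ k) (coding a v)).
    split => //.
    have [|d d0 hd] := @gap_tuples a n (wmap a (mkseq v m ++ k) (coding a v)).
      move=> i j ij v'; rewrite -wmap_cat.
      by apply: (hk (i, j)) => //; rewrite mem_enum.
    exists (wmap a (mkseq v m ++ k) (coding a v)), d; split => //.
    by rewrite subrr modulus0 mulr0.
  rewrite {1}(coding_shift a v m) wmap_cat; apply: le_lt_trans (hm m (leqnn m)).
  apply: wmap_mkseq_dist; apply: le_trans (modulusD _ _) _; rewrite modulusN.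
  have := coding_radius a (shift m v).
  have : modulus (wmap a k (coding a v)) <= radius a.
    by apply/wmap_radius/coding_radius.
  lra.
move=> s t st; apply/seteqP; split => // _ [[z [x [e [[v _ <-] he zx]]] <-]].
move=> [z' [x' [e' [[v' _ <-] he' zx']]]] E.
have h1 := he _ _ st v'.
have ts : t != s by rewrite eq_sym.
have h2 := he' _ _ ts v; rewrite modulusC in h2.
have le_dist (u : n.-tuple 'I_N) y y' :
    modulus (wmap a u y - wmap a u y') <= modulus (y - y').
  rewrite wmap_dist ler_piMl //; apply: le_trans (ratio_le _) _.
  by rewrite exprn_ile1 ?ltW //; case/andP: rho01.
have d1 := le_dist s z (coding a v); rewrite modulusC in d1.
have d2 := le_dist t z' (coding a v').
have := modulus_triangle (wmap a s z) (wmap a s (coding a v)) (wmap a t (coding a v')).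
have Ew : wmap a t z' = wmap a s z by exact: E.
rewrite Ew in d2; lra.
Qed.

(** * Openness and density of each non-inclusion *)

(** By linearity pi_a'(v) - pi_a(v) = pi_(a' - a)(v), whose modulus is at most
    [radius (a' - a)]; this bound is what makes pi_a(v) continuous in [a]
    uniformly in [v]. *)
Lemma radius_continuous (e : R) : 0 < e ->
  exists2 d : R, 0 < d & forall a a', ball a d a' -> radius (a' - a) < e.
Proof.
move=> e0; have N1 : 0 < N%:R + 1 :> R by rewrite ltr_wpDl.
have c0 : 0 < 4 * (N%:R + 1) / (1 - rho) :> R by rewrite divr_gt0 // mulr_gt0.
exists (e / (4 * (N%:R + 1) / (1 - rho))); first by rewrite divr_gt0.
set d := e / _ => a a' [d0 aa'].
have colE i : modulus (col i (a' - a)) <= 2 * d.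
  rewrite linearB /= modulusC; apply/ltW/ball_modulus_lt; split => // p q.
  by rewrite !mxE; exact: aa'.
have le_sum : \sum_i modulus (col i (a' - a)) <= N%:R * (2 * d).
  apply: le_trans (ler_sum _ (fun i _ => colE i)) _.
  by rewrite sumr_const card_ord (mulr_natl _ N).
rewrite /radius ltr_pdivrMr //.
have -> : e * (1 - rho) = d * (4 * (N%:R + 1)).
  by rewrite /d; field; rewrite (gt_eqF rho_lt1) (gt_eqF N1).
move: le_sum d0; set T := \sum_i _; lra.
Qed.

Lemma open_escapes i j k : open (escapes i j k).
Proof.
rewrite openE => a [v /cylinder_gap[e e0 he]].
have e20 : 0 < e / 2 by rewrite divr_gt0.
have [d d0 hd] := radius_continuous e20.
apply/nbhs_ballP; exists d => // a' /hd; set c := a' - a => ce.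
have -> : a' = a + cmx (cplx 1 0) *m c by rewrite cmx1 addrC subrK.
exists v => v'; rewrite !coding_linear !wmap_linear !cmx1 => E.
set y := wmap c j (coding c v'); set x := wmap c (i ++ k) (coding c v).
have xr : modulus x <= radius c by apply/wmap_radius/coding_radius.
have yr : modulus y <= radius c by apply/wmap_radius/coding_radius.
have := he v'; have -> : wmap a (i ++ k) (coding a v) - wmap a j (coding a v') = y - x.
  by apply/eqP; rewrite subr_eq addrAC eq_sym subr_eq addrC -E addrC.
have := modulusD y (- x); rewrite modulusN; lra.
Qed.

Lemma ratio_mkseq v m : ratio (mkseq v m) = \prod_(p < m) modulus (b (v p)).
Proof. by rewrite /ratio big_map -{1}(subn0 m) -/(index_iota 0 m) big_mkord. Qed.

(** On a complex line through a parameter that satisfies the non-inclusion, the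
    bad parameters are covered, for each [m], by one square of half-side
    [K * ratio l] per word [l] of length [m]; their total area tends to 0. *)
Lemma escapes_line a c i j k (e : R) :
  \sum_i modulus (b i) ^+ 2 < 1 -> 0 < e -> escapes i j k c ->
  exists t, [/\ `|re t| <= e, `|im t| <= e & escapes i j k (a + cmx t *m c)].
Proof.
move=> sum1 e0 [v /cylinder_gap[d d0 hd]]; apply: contrapT => bad.
(* [t] is bad for [v'] when [fa v' + t * fc v' = 0]. *)
pose fa v' : 'cV[R]_2 := wmap a (i ++ k) (coding a v) - wmap a j (coding a v').
pose fc v' : 'cV[R]_2 := wmap c (i ++ k) (coding c v) - wmap c j (coding c v').
have collide t : `|re t| <= e -> `|im t| <= e ->
    exists v', fa v' = - (cmx t *m fc v').
  move=> rt it; have : ~ escapes i j k (a + cmx t *m c).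
    by move=> h; apply: bad; exists t.
  move=> /forallNP/(_ v)/existsNP[v' /contrapT].
  rewrite !coding_linear !wmap_linear => E; exists v'.
  apply/eqP; rewrite -subr_eq0 opprK mulmxBr addrACA -opprD subr_eq0.
  exact/eqP.
have lip (x : 'M[R]_(2, N)) m v1 v2 : mkseq v1 m = mkseq v2 m ->
    modulus (wmap x j (coding x v1) - wmap x j (coding x v2))
      <= 2 * radius x * ratio (mkseq v1 m).
  move=> /(coding_prefix_dist x); apply: le_trans; rewrite wmap_dist ler_piMl //.
  apply: le_trans (ratio_le _) _.
  by rewrite exprn_ile1 ?ltW //; case/andP: rho01.
(* From [fa v1 + t * fc v1 = 0] and [fa v2 + t' * fc v2 = 0] one gets
   [(t - t') * fc v1 = (fa v2 - fa v1) - t' * (fc v1 - fc v2)], where [fc v1] has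
   modulus at least [d] and both differences are at most a constant times the
   ratio of the common cylinder. *)
pose K := (2 * radius a + 2 * e * (2 * radius c)) / d.
have K0 : 0 <= K.
  apply: divr_ge0; last exact: ltW.
  have := radius_ge0 a; have := mulr_ge0 (ltW e0) (radius_ge0 c); lra.
have close m t t' v1 v2 : `|re t'| <= e -> `|im t'| <= e ->
    mkseq v1 m = mkseq v2 m -> fa v1 = - (cmx t *m fc v1) ->
    fa v2 = - (cmx t' *m fc v2) -> modulus (t - t') <= K * ratio (mkseq v1 m).
  move=> rt it v12 E1 E2.
  have t'e : modulus t' <= 2 * e by have := modulus_le t'; lra.
  rewrite /K mulrAC ler_pdivlMr //.
  apply: le_trans (_ : modulus (t - t') * modulus (fc v1) <= _).
    by rewrite ler_wpM2l // hd.
  rewrite -modulusM.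
  have -> : cmx (t - t') *m fc v1 = (fa v2 - fa v1) - cmx t' *m (fc v1 - fc v2).
    by rewrite E1 E2; apply: cplx_eq; rewrite !cE; ring.
  apply: le_trans (modulusD _ _) _; rewrite modulusN modulusM mulrDl.
  have la := lip a _ _ _ v12; have lc := lip c _ _ _ v12.
  have -> : fa v2 - fa v1 = wmap a j (coding a v1) - wmap a j (coding a v2).
    by rewrite /fa opprB addrC subrKA.
  have -> : fc v1 - fc v2 = - (wmap c j (coding c v1) - wmap c j (coding c v2)).
    by rewrite /fc opprB addrC subrKA opprB.
  by rewrite modulusN lerD // -[2 * e * _ * _]mulrA ler_pM.
have q01 : 0 < \sum_i modulus (b i) ^+ 2 < 1.
  rewrite sum1 andbT (bigD1 (v 0%N)) //= ltr_pwDl ?exprn_gt0 //.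
  by apply: sumr_ge0 => p _; rewrite sqr_ge0.
have K20 : 0 <= (2 * K) ^+ 2 by rewrite sqr_ge0.
have e20 : 0 < (2 * e) ^+ 2 by rewrite exprn_gt0 // mulr_gt0.
have [m hm] := small_geometric q01 K20 e20.
have := hm m (leqnn m); apply/negP; rewrite -leNgt.
pose rad (f : {ffun 'I_m -> 'I_N}) := K * \prod_p modulus (b (f p)).
(* The square of [f] is centred at any bad parameter of the cylinder [f]; the
   origin is a default for cylinders without bad parameters. *)
have [|cen hcen] := @choice {ffun 'I_m -> 'I_N} (R * R)%type (fun f z => forall t' v',
    `|re t'| <= e -> `|im t'| <= e -> [ffun p : 'I_m => v' p] = f ->
    fa v' = - (cmx t' *m fc v') ->
    `|re t' - z.1| <= rad f /\ `|im t' - z.2| <= rad f).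
  move=> f; have [[[t v1] [rt it vf E]]|none] := pselect (exists
    tv : 'cV[R]_2 * (nat -> 'I_N),
    [/\ `|re tv.1| <= e, `|im tv.1| <= e, [ffun p : 'I_m => tv.2 p] = f
      & fa tv.2 = - (cmx tv.1 *m fc tv.2)]); last first.
    by exists (0, 0) => t' v' h1 h2 h3 h4; case: none; exists (t', v').
  exists (re t, im t) => t' v' rt' it' vf' E' /=.
  have v12 : mkseq v' m = mkseq v1 m by apply: eq_mkseq_ord; rewrite vf vf'.
  have := close m _ _ _ _ rt it v12 E' E.
  have -> : K * ratio (mkseq v' m) = rad f.
    rewrite ratio_mkseq /rad -vf'; congr (_ * _).
    by apply: eq_bigr => p _; rewrite ffunE.
  by move=> le; rewrite -!reN -!imN -!reD -!imD; split; apply: le_trans le;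
    [exact: re_le_modulus | exact: im_le_modulus].
(* The squared ratios of the words of length [m] add up to an [m]-th power. *)
have -> : (2 * K) ^+ 2 * (\sum_i modulus (b i) ^+ 2) ^+ m =
    \sum_(f : {ffun 'I_m -> 'I_N}) (2 * rad f) ^+ 2.
  rewrite -[in LHS](card_ord m) -prodr_const bigA_distr_bigA /= mulr_sumr.
  by apply: eq_bigr => f _; rewrite /rad mulrA [RHS]exprMn prodrXl.
apply: (square_cover_le (c := cen)); first exact: ltW.
  by move=> f; rewrite mulr_ge0 // prodr_ge0.
move=> p q pe qe; have [||v' E] := collide (cplx p q); rewrite ?re_cplx ?im_cplx //.
exists [ffun r : 'I_m => v' r]; first by rewrite mem_index_enum.
by have := hcen _ (cplx p q) v' _ _ erefl E; rewrite !re_cplx !im_cplx; exact.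
Qed.

Lemma dense_escapes c i j k :
  \sum_i modulus (b i) ^+ 2 < 1 -> escapes i j k c -> dense (escapes i j k).
Proof.
move=> sum1 hc V [a Va]; rewrite openE => /(_ a Va)/nbhs_ballP[d /= d0 dV].
pose S := \sum_i modulus (col i c).
have S0 : 0 <= S by apply: sumr_ge0.
have e0 : 0 < d / (2 * (S + 1)) by rewrite divr_gt0 // mulr_gt0 // ltr_wpDl.
have [t [rt it ht]] := escapes_line a sum1 e0 hc.
exists (a + cmx t *m c); split => //; apply/dV/ball_columns => // q.
have -> : col q a - col q (a + cmx t *m c) = - (cmx t *m col q c).
  by rewrite linearD /= opprD addNKr !colE mulmxA.
rewrite modulusN modulusM.
have qS : modulus (col q c) <= S by rewrite /S (bigD1 q) //= lerDl sumr_ge0.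
apply: le_lt_trans (_ : 2 * (d / (2 * (S + 1))) * S < d).
  by rewrite ler_pM //; have := modulus_le t; lra.
rewrite (_ : _ * S = d * (S / (S + 1))); last by field; rewrite gt_eqF // ltr_wpDl.
by rewrite gtr_pMr // ltr_pdivrMr ?mul1r ?ltrDl // ltr_wpDl.
Qed.

(** * The parameters with the strong Markov property *)

(** [escapes] indexed by natural numbers, through the countability of triples of
    words. *)
Definition escape_condition n : set 'M[R]_(2, N) :=
  if unpickle n is Some (i, j, k) then
    if (size i == size j) && (i != j) then escapes i j k else setT
  else setT.

Lemma all_escape_bigcap : all_escape = \bigcap_n escape_condition n.
Proof.
apply/seteqP; split=> [a ha n _|a ha i j k ij neq].
  rewrite /escape_condition; case: unpickle => // -[[i j] k].
  by case: ifP => // /andP[/eqP ij neq]; exact: ha.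
have := ha (pickle (i, j, k)) I; rewrite /escape_condition pickleK.
by rewrite ij eqxx neq.
Qed.

Lemma open_escape_condition n : open (escape_condition n).
Proof.
rewrite /escape_condition; case: unpickle => [[[i j] k]|]; last exact: openT.
by case: ifP => _; [exact: open_escapes | exact: openT].
Qed.

Lemma Gdelta_all_escape : Gdelta all_escape.
Proof.
exists escape_condition; first exact: open_escape_condition.
exact: all_escape_bigcap.
Qed.

Lemma dense_all_escape c :
  \sum_i modulus (b i) ^+ 2 < 1 -> all_escape c -> dense all_escape.
Proof.
move=> sum1 hc; rewrite all_escape_bigcap.
apply: (@Baire R 'M[R]_(2, N)) => n; split; first exact: open_escape_condition.
rewrite /escape_condition; case: unpickle => [[[i j] k]|].
  case: ifP => [/andP[/eqP ij neq]|_].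
    exact: dense_escapes sum1 (hc i j k ij neq).
  by move=> V V0 _; rewrite setIT.
by move=> V V0 _; rewrite setIT.
Qed.

End Coding.

Lemma similarity_cmx (R : realType) (s : R) (U : 'M[R]_2) :
  0 < s -> is_rotation U -> exists2 z, s *: U = cmx z & modulus z = s.
Proof.
move=> s0 [th ->]; exists (cplx (s * cos th) (s * sin th)).
  apply/matrixP => i j; rewrite !mxE re_cplx im_cplx.
  by do 2 case: ifP => // _; rewrite mulrN.
rewrite /modulus !cE !exprMn -mulrDr cos2Dsin2 mulr1 sqrtr_sqr.
by rewrite ger0_norm // ltW.
Qed.

Unset Implicit Arguments.

Theorem theorem5 (R : realType) (N : nat) (hN : (0 < N)%N)
    (sigma : 'I_N -> R) (U : 'I_N -> 'M[R]_2) (B : 'I_N -> 'M[R]_2)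
    (hsigma : forall i, 0 < sigma i < 1)
    (hU : forall i, is_rotation (U i))
    (hB : forall i, B i = sigma i *: U i)
    (hsum : \sum_(i < N) sigma i ^+ 2 < 1) :
  E2 B = set0 \/ (dense (E2 B) /\ Gdelta (E2 B)).
Proof.
have [|b hb] := @choice _ _ (fun i z => B i = cmx z /\ modulus z = sigma i).
  move=> i; have /andP[s0 _] := hsigma i.
  by have [z zE zs] := similarity_cmx s0 (hU i); exists z; rewrite hB.
have -> : B = fun i => cmx (b i) by apply/funext => i; case: (hb i).
have modb i : modulus (b i) = sigma i by case: (hb i).
have b_gt0 i : 0 < modulus (b i) by rewrite modb; case/andP: (hsigma i).
(* The default 1/2 of the maximum lies in (0, 1), as [rho] has to. *)
pose rho : R := \big[Num.max/2^-1]_i sigma i.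
have b_le i : modulus (b i) <= rho by rewrite modb; exact: le_bigmax.
have rho01 : 0 < rho < 1.
  apply/andP; split.
    by apply: lt_le_trans (bigmax_ge_id _ _ _ _); rewrite invr_gt0.
  by apply: bigmax_lt => [|i _]; [rewrite invf_lt1 // ltr1n | case/andP: (hsigma i)].
have sum1 : \sum_i modulus (b i) ^+ 2 < 1.
  by rewrite (eq_bigr (fun i => sigma i ^+ 2)) // => i _; rewrite modb.
have E2E : E2 (fun i => cmx (b i)) = all_escape b_gt0 b_le rho01.
  apply/seteqP; split=> a; first exact: SMP_all_escape.
  exact: all_escape_SMP.
rewrite E2E; have [->|/set0P[c hc]] := eqVneq (all_escape b_gt0 b_le rho01) set0.
  by left.
by right; split; [exact: dense_all_escape hc | exact: Gdelta_all_escape].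
Qed.
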